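(* Let $r\ge 2$, let $W$ be the Weyl group of type $B_r$, let $\tilde\alpha$ be the highest root and $\varpi_1=\alpha_1+\cdots+\alpha_r$ the first fundamental weight, and let $\mathcal B_r(\tilde\alpha,\varpi_1)=\{\sigma\in W:\wp(\sigma(\tilde\alpha+\rho)-(\varpi_1+\rho))>0\}$. Let $\sigma\in W$. Then $\sigma\in\mathcal B_r(\tilde\alpha,\varpi_1)$ if and only if $\sigma=1$ or $\sigma=s_{i_1}s_{i_2}\cdots s_{i_j}$, where $i_1,\ldots,i_j$ are non-consecutive integers between $3$ and $r$.
   Context: Type $B_r$ ($\mathfrak{so}_{2r+1}(\mathbb C)$): simple roots $\alpha_i=\varepsilon_i-\varepsilon_{i+1}$ for $1\le i\le r-1$ and $\alpha_r=\varepsilon_r$; positive roots $\Phi^+=\{\varepsilon_i-\varepsilon_j,\varepsilon_i+\varepsilon_j:1\le i<j\le r\}\cup\{\varepsilon_i:1\le i\le r\}$; highest root $\tilde\alpha=\alpha_1+2\alpha_2+\cdots+2\alpha_r$; $\rho=\frac12\sum_{\alpha\in\Phi^+}\alpha$. $s_i$ denotes the simple reflection in $\alpha_i$. $\wp(\xi)$ is Kostant's partition function: the number of ways $\xi$ may be written as a nonnegative integral sum of positive roots. Integers $i_1,\dots,i_j$ are called non-consecutive if they are distinct and no two of them differ by $1$; ''between $3$ and $r$'' is inclusive. *)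

(* Defs.v *)
From HB Require Import structures.
From mathcomp Require Import all_boot all_order all_algebra.
From mathcomp Require Import finmap.
From mathcomp Require Import mathcomp_extra boolp classical_sets functions cardinality.

Set Implicit Arguments.
Unset Strict Implicit.
Unset Printing Implicit Defensive.

Import Order.TTheory GRing.Theory Num.Theory.
Local Open Scope classical_set_scope.
Local Open Scope ring_scope.

(* Weights are column vectors over rat: every vector involved has coordinates
   in (1/2)Z.  Indices 1, ..., r are kept 1-based, so [eps r k] is the k-th
   standard basis vector for 1 <= k <= r, and row j of a vector (j : 'I_r)
   holds its coordinate on eps_(j+1). *)
Definition eps (r k : nat) : 'cV[rat]_r := \col_j (j.+1 == k)%:R.

Definition alpha (r i : nat) : 'cV[rat]_r :=
  if i == r then eps r r else eps r i - eps r i.+1.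

Definition posroots (r : nat) : seq 'cV[rat]_r :=
  [seq eps r i - eps r j | i <- index_iota 1 r.+1, j <- index_iota i.+1 r.+1]
  ++ [seq eps r i + eps r j | i <- index_iota 1 r.+1, j <- index_iota i.+1 r.+1]
  ++ [seq eps r i | i <- index_iota 1 r.+1].

Definition roots (r : nat) : seq 'cV[rat]_r :=
  posroots r ++ [seq - a | a <- posroots r].

Definition rho (r : nat) : 'cV[rat]_r :=
  2^-1 *: \sum_(a : seq_sub (posroots r)) val a.

Definition highest_root (r : nat) : 'cV[rat]_r :=
  alpha r 1 + \sum_(2 <= i < r.+1) 2 *: alpha r i.

Definition varpi1 (r : nat) : 'cV[rat]_r := \sum_(1 <= i < r.+1) alpha r i.

Definition dot (r : nat) (u v : 'cV[rat]_r) : rat := \sum_(j < r) u j 0 * v j 0.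

(* Matrix of v |-> v - (2 (v, a) / (a, a)) a. *)
Definition reflection (r : nat) (a : 'cV[rat]_r) : 'M[rat]_r :=
  1%:M - (2 / dot a a) *: (a *m a^T).

Definition simple_reflection (r i : nat) : 'M[rat]_r := reflection (alpha r i).

(* Reflections are involutions, so the products of reflections in roots form
   the whole group generated by these reflections. *)
Definition weyl (r : nat) : set 'M[rat]_r :=
  [set w | exists2 t : seq 'cV[rat]_r,
     {subset t <= roots r} & w = \big[mulmx/1%:M]_(a <- t) reflection a].
Arguments weyl : clear implicits.

(* A way of writing xi is a multiplicity function on the positive roots. *)
Definition partitions (r : nat) (xi : 'cV[rat]_r) :
    set {ffun seq_sub (posroots r) -> nat} :=
  [set m | \sum_(a : seq_sub (posroots r)) val a *+ m a = xi].

(* [fset_set] sends an infinite set to the empty one; this never happens here,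
   by [finite_partitions] below. *)
Definition kostant (r : nat) (xi : 'cV[rat]_r) : nat :=
  #|` fset_set (partitions xi)|.

Lemma posroots_form_ge1 (r : nat) (a : 'cV[rat]_r) :
  a \in posroots r -> 1 <= \sum_(j < r) (r - j)%:R * a j 0.
Proof.
have form_eps k : (0 < k <= r)%N ->
    \sum_(j < r) (r - j)%:R * eps r k j 0 = (r.+1 - k)%:R :> rat.
  case: k => [//|k] /= kr; rewrite (bigD1 (Ordinal kr)) //= big1 ?addr0.
    by rewrite mxE eqxx mulr1 subSS.
  by move=> j jk; rewrite mxE eqSS -[k]/(val (Ordinal kr)) (inj_eq val_inj)
    (negbTE jk) mulr0.
rewrite !mem_cat => /or3P[/allpairsPdep|/allpairsPdep|/mapP].
- case=> i [j []]; rewrite !mem_index_iota => /andP[i0 ir] /andP[ij jr] ->.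
  under eq_bigr do rewrite mxE [X in _ + X]mxE mulrBr.
  rewrite sumrB !form_eps ?i0 ?(leq_trans _ ij) // -natrB; last first.
    by rewrite leq_sub2l // ltnW.
  by rewrite ler1n subn_gt0 ltn_sub2l // (leq_trans ij).
- case=> i [j []]; rewrite !mem_index_iota => /andP[i0 ir] /andP[ij jr] ->.
  under eq_bigr do rewrite mxE mulrDr.
  rewrite big_split /= !form_eps ?i0 ?(leq_trans _ ij) // -natrD ler1n.
  by rewrite addn_gt0 subn_gt0 ir.
- by case=> i; rewrite mem_index_iota => /andP[i0 ir] ->;
    rewrite form_eps ?i0 // ler1n subn_gt0.
Qed.

Lemma finite_partitions (r : nat) (xi : 'cV[rat]_r) :
  finite_set (partitions xi).
Proof.
pose h (v : 'cV[rat]_r) : rat := \sum_(j < r) (r - j)%:R * v j 0.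
have hsum (m : {ffun seq_sub (posroots r) -> nat}) :
    partitions xi m -> h xi = \sum_a (h (val a) *+ m a).
  move=> <-; rewrite /h; under [RHS]eq_bigr do rewrite -sumrMnl.
  rewrite exchange_big /=; apply: eq_bigr => j _.
  by rewrite summxE mulr_sumr; apply: eq_bigr => a _; rewrite mulmxnE mulrnAr.
pose N := Num.bound `|h xi|.
pose F (g : {ffun seq_sub (posroots r) -> 'I_N.+1}) :
  {ffun seq_sub (posroots r) -> nat} := [ffun a => val (g a)].
apply: (@sub_finite_set _ _ (F @` setT)); last first.
  exact/finite_image/finite_finset.
move=> m mxi; exists [ffun a => inord (m a)] => //.
apply/ffunP => a; rewrite !ffunE /= inordK // ltnS -(ler_nat rat).
apply: le_trans (_ : h xi <= _); last first.
  exact: le_trans (ler_norm _) (ltW (archi_boundP (normr_ge0 _))).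
rewrite (hsum _ mxi) (bigD1 a) //=.
have h1 (b : seq_sub (posroots r)) : 1 <= h (val b).
  by apply: posroots_form_ge1; exact: ssvalP.
apply: ler_wpDr; last by rewrite lerMn2r h1 orbT.
by apply: sumr_ge0 => b _; rewrite mulrn_wge0 // (le_trans _ (h1 b)).
Qed.

Definition alternation_set (r : nat) (lambda mu : 'cV[rat]_r) : set 'M[rat]_r :=
  [set w | weyl r w /\
     (0 < kostant (w *m (lambda + rho r) - (mu + rho r)))%N].

Definition non_consecutive (t : seq nat) : Prop :=
  uniq t /\ {in t &, forall i j : nat, j <> i.+1}.

(* Main.v *)
Require Import Defs.
From HB Require Import structures.
From mathcomp Require Import all_boot all_order all_algebra fingroup perm.
From mathcomp Require Import finmap lra ring.
From mathcomp Require Import mathcomp_extra boolp classical_sets functions cardinality.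

(** Write lambda for the highest root and mu for varpi_1. In coordinates
    lambda = eps_1 + eps_2 and mu = eps_1, so lambda - mu = eps_2
    = alpha_2 + ... + alpha_r, and rho = (r - 1/2, ..., 3/2, 1/2). A vector has
    a partition only if its coefficients on the simple roots, which are the
    partial sums of its coordinates, are all nonnegative.

    If sigma is a product of simple reflections s_i over a set t of
    non-consecutive i >= 3, these commute, and each lowers lambda + rho by
    exactly alpha_i ([prod_simple_reflection_lambda_rho]). Hence
    sigma (lambda + rho) - (mu + rho) is the sum of the alpha_i with
    2 <= i <= r outside t, which is visibly a sum of positive roots.

    Conversely, let sigma be any Weyl group element, that is a signed
    permutation ([weyl_signed_perm]), for which all these partial sums are
    nonnegative. The first two coordinates of lambda + rho are so large that
    sigma has to leave them in place ([first_two_fixed]), after which the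
    partial sum equals 1. The remaining coordinates are consecutive
    half-integers ending in 1/2, so at the first position where
    sigma (lambda + rho) differs from lambda + rho the value drops, and by
    exactly 1, all that the partial sum allows. The next position must then
    compensate immediately, so that two neighbours are swapped, or else it was
    the final 1/2 that changed its sign
    ([reflect_first_change]). Undoing this by one simple reflection settles both
    positions, and induction writes sigma as a product of simple reflections no
    two of which are adjacent ([peel_simple_reflections]). Regularity of
    lambda + rho ([lambda_rho_regular]) turns the resulting equality of weights
    into an equality in the group. *)

Set Implicit Arguments.
Unset Strict Implicit.
Unset Printing Implicit Defensive.

Import Order.TTheory GRing.Theory Num.Theory.
Local Open Scope classical_set_scope.
Local Open Scope ring_scope.

(** * Coordinates and the dual basis *)

Lemma dotC (r : nat) (u v : 'cV[rat]_r) : dot u v = dot v u.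
Proof. by apply: eq_bigr => j _; rewrite mulrC. Qed.

Lemma dotDr (r : nat) (u v w : 'cV[rat]_r) : dot u (v + w) = dot u v + dot u w.
Proof. by rewrite -big_split; apply: eq_bigr => j _; rewrite mxE mulrDr. Qed.

Lemma dotNr (r : nat) (u v : 'cV[rat]_r) : dot u (- v) = - dot u v.
Proof. by rewrite -sumrN; apply: eq_bigr => j _; rewrite mxE mulrN. Qed.

Lemma dotBr (r : nat) (u v w : 'cV[rat]_r) : dot u (v - w) = dot u v - dot u w.
Proof. by rewrite dotDr dotNr. Qed.

Lemma dotZr (r : nat) (c : rat) (u v : 'cV[rat]_r) :
  dot u (c *: v) = c * dot u v.
Proof. by rewrite mulr_sumr; apply: eq_bigr => j _; rewrite mxE mulrCA. Qed.

Lemma dotDl (r : nat) (u v w : 'cV[rat]_r) : dot (v + w) u = dot v u + dot w u.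
Proof. by rewrite dotC dotDr !(dotC u). Qed.

Lemma dotBl (r : nat) (u v w : 'cV[rat]_r) : dot (v - w) u = dot v u - dot w u.
Proof. by rewrite dotC dotBr !(dotC u). Qed.

Lemma dotZl (r : nat) (c : rat) (u v : 'cV[rat]_r) :
  dot (c *: v) u = c * dot v u.
Proof. by rewrite dotC dotZr dotC. Qed.

Lemma dot_sumr (r : nat) (I : Type) (s : seq I) (F : I -> 'cV[rat]_r) u :
  dot u (\sum_(i <- s) F i) = \sum_(i <- s) dot u (F i).
Proof.
elim/big_rec2: _ => [|i x y _ <-]; last by rewrite dotDr.
by apply: big1 => j _; rewrite mxE mulr0.
Qed.

Lemma sub_coord (r : nat) (u v : 'cV[rat]_r) j : (u - v) j 0 = u j 0 - v j 0.
Proof. by rewrite mxE [X in _ + X]mxE. Qed.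

Lemma eps_coord (r k : nat) (j : 'I_r) : eps r k j 0 = (j.+1 == k)%:R.
Proof. by rewrite mxE. Qed.

Lemma dot_eps (r : nat) (j : 'I_r) (v : 'cV[rat]_r) :
  dot (eps r j.+1) v = v j 0.
Proof.
rewrite /dot (bigD1 j) //= big1 ?addr0 => [|k].
  by rewrite mxE eqxx mul1r.
by rewrite -val_eqE /= => /negbTE jk; rewrite mxE eqSS jk mul0r.
Qed.

Lemma dot_eps_eps (r i j : nat) :
  (0 < i <= r)%N -> dot (eps r i) (eps r j) = (i == j)%:R.
Proof. by case: i => // i ir; rewrite (dot_eps (Ordinal ir)) mxE. Qed.

(** The basis dual to the simple roots for [dot]: pairing a vector with
    [coweight r k] reads off its coefficient on alpha_k, which in coordinates is
    the sum of the first k entries. *)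
Definition coweight (r k : nat) : 'cV[rat]_r := \sum_(1 <= i < k.+1) eps r i.

Lemma coweightS (r k : nat) : coweight r k.+1 = coweight r k + eps r k.+1.
Proof. by rewrite /coweight big_nat_recr. Qed.

Lemma dot_coweight (r k : nat) (v : 'cV[rat]_r) :
  dot (coweight r k) v = \sum_(1 <= i < k.+1) dot (eps r i) v.
Proof. by rewrite dotC dot_sumr; under eq_bigr do rewrite dotC. Qed.

Lemma dot_coweight_eps (r k j : nat) : (0 < j <= r)%N -> (k <= r)%N ->
  dot (coweight r k) (eps r j) = (j <= k)%N%:R.
Proof.
move=> /andP[j0 jr]; elim: k => [|k IHk] kr.
  by rewrite dot_coweight big_geq // leqNgt j0.
rewrite coweightS dotDl IHk ?(ltnW kr) // dot_eps_eps //.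
rewrite [in RHS]leq_eqVlt ltnS eq_sym; case: eqVneq => [->|_].
  by rewrite ltnn add0r.
by rewrite addr0.
Qed.

(** * Positive roots, rho and the partition function *)

Lemma mem_pair_range (r i j : nat) :
  i \in index_iota 1 r.+1 -> j \in index_iota i.+1 r.+1 ->
  [/\ (0 < i <= r)%N, (0 < j <= r)%N & (i < j)%N].
Proof.
rewrite !mem_index_iota !ltnS => /andP[i0 ir] /andP[ij jr].
by rewrite i0 ij ir jr (leq_trans _ ij).
Qed.

Lemma alpha_posroots (r i : nat) : (0 < i <= r)%N -> alpha r i \in posroots r.
Proof.
move=> /andP[i0 ir]; rewrite /posroots /alpha !mem_cat.
case: eqP => [|/eqP] ir'.
  by apply/or3P/Or33/mapP; exists r; rewrite // mem_index_iota -ir' i0 leqnn.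
apply/or3P/Or31/allpairsPdep; exists i, i.+1; split=> //.
  by rewrite mem_index_iota i0.
by rewrite mem_index_iota leqnn ltnS ltn_neqAle ir' ir.
Qed.

Lemma dot_coweight_posroot (r k : nat) (a : 'cV[rat]_r) :
  (k <= r)%N -> a \in posroots r -> 0 <= dot (coweight r k) a.
Proof.
move=> kr; rewrite !mem_cat => /or3P[/allpairsPdep|/allpairsPdep|/mapP].
- move=> [i [j [i_in j_in ->]]]; have [ir jr ij] := mem_pair_range i_in j_in.
  rewrite dotBr !dot_coweight_eps // subr_ge0 ler_nat.
  by case: (leqP j k) => // /(leq_trans (ltnW ij)) ->.
- move=> [i [j [i_in j_in ->]]]; have [ir jr ij] := mem_pair_range i_in j_in.
  by rewrite dotDr !dot_coweight_eps // addr_ge0.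
- by move=> [i]; rewrite mem_index_iota => ir ->; rewrite dot_coweight_eps.
Qed.

(** Needed because [rho] sums over the set underlying the list, while its
    coordinates are computed along the list. *)
Lemma posroots_uniq (r : nat) : uniq (posroots r).
Proof.
(* The coordinate sum separates the three families: it is 0, 2 and 1. *)
have tot_eps i : (0 < i <= r)%N ->
    dot (coweight r r) (eps r i) = 1.
  by move=> ir; rewrite dot_coweight_eps //; case/andP: ir => _ ->.
have pair_uniq (c : rat) f : c = 1 \/ c = -1 ->
    (forall i j, f i j = eps r i + c *: eps r j) ->
    uniq [seq f i j | i <- index_iota 1 r.+1, j <- index_iota i.+1 r.+1].
  move=> c1 fE; apply: allpairs_uniq_dep; rewrite ?iota_uniq //.
    by move=> i _; apply: iota_uniq.
  move=> _ _ /allpairsPdep[i [j [+ + ->]]] /allpairsPdep[k [l [+ + ->]]] /=.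
  move=> i_in j_in k_in l_in E.
  have [ir jr ij] := mem_pair_range i_in j_in.
  have [kr lr kl] := mem_pair_range k_in l_in.
  (* The coordinates at i and k force k = i, then the one at j forces l = j. *)
  have at_ x : (0 < x <= r)%N ->
      (x == i)%:R + c * (x == j)%:R = (x == k)%:R + c * (x == l)%:R :> rat.
    move=> xr; have := congr1 (dot (eps r x)) E.
    by rewrite !fE !dotDr !dotZr !dot_eps_eps.
  have ki : k = i.
    have := at_ _ ir; have := at_ _ kr.
    rewrite !eqxx (ltn_eqF ij) (ltn_eqF kl) (eq_sym i k).
    case: (eqVneq k i) => // _; case: (eqVneq k j) => [kj|_]; last first.
      by move=> /= ? ?; exfalso; lra.
    case: (eqVneq i l) => [il|_]; last by move=> /= ? ?; exfalso; lra.
    by move: ij kl; rewrite kj il => /ltn_trans /[apply]; rewrite ltnn.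
  rewrite ki in at_ *; have := at_ _ jr; rewrite (gtn_eqF ij).
  by rewrite !eqxx; case: (eqVneq j l) => [-> //|_]; case: c1 => -> /eqP.
rewrite /posroots !cat_uniq.
apply/and4P; split.
- by apply: (pair_uniq (-1)) => [|i j]; rewrite ?scaleN1r //; right.
- have tot_m v : v \in [seq eps r i - eps r j | i <- index_iota 1 r.+1,
      j <- index_iota i.+1 r.+1] ->
    dot (coweight r r) v = 0.
    move=> /allpairsPdep[i [j [i_in j_in ->]]].
    have [ir jr _] := mem_pair_range i_in j_in.
    by rewrite dotBr !tot_eps ?subrr.
  apply/hasPn => v; rewrite mem_cat => /orP[/allpairsPdep[i [j]]|/mapP[i]].
    move=> [i_in j_in ->]; have [ir jr _] := mem_pair_range i_in j_in.
    by apply/negP => /tot_m; rewrite dotDr !tot_eps.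
  rewrite mem_index_iota => ir ->.
  by apply/negP => /tot_m; rewrite tot_eps.
- by apply: (pair_uniq 1) => [|i j]; rewrite ?scale1r //; left.
apply/andP; split.
  apply/hasPn => _ /mapP[k + ->]; rewrite mem_index_iota => kr.
  apply/negP => /allpairsPdep[i [j [i_in j_in /(congr1 (dot (coweight r r)))]]].
  have [ir jr _] := mem_pair_range i_in j_in.
  by rewrite dotDr !tot_eps.
rewrite map_inj_in_uniq ?iota_uniq // => i j.
rewrite !mem_index_iota => ir jr /(congr1 (dot (eps r i))).
rewrite !dot_eps_eps // eqxx.
by case: eqVneq.
Qed.

Lemma sum_seq_sub {V : nmodType} {T : choiceType} (s : seq T) (F : T -> V) :
  uniq s -> \sum_(a : seq_sub s) F (val a) = \sum_(x <- s) F x.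
Proof.
move=> s_uniq; rewrite -(big_map val xpredT F); apply: perm_big.
apply: uniq_perm => // [|x].
  by rewrite (map_inj_uniq val_inj) index_enum_uniq.
apply/mapP/idP => [[a _ ->]|xs]; first exact: ssvalP.
by exists (SeqSub xs); rewrite ?mem_index_enum.
Qed.

Lemma kostant_gt0 (r : nat) (xi : 'cV[rat]_r) :
  (0 < kostant xi)%N <-> partitions xi !=set0.
Proof.
have fin := finite_partitions xi.
rewrite /kostant cardfs_gt0; split => [/fset0Pn[m]|[m mxi]].
  by rewrite in_fset_set // inE; exists m.
by apply/fset0Pn; exists m; rewrite in_fset_set // inE.
Qed.

(** A list of positive roots, read as a multiset, is a partition of its sum. *)
Lemma kostant_gt0_sum (r : nat) (s : seq 'cV[rat]_r) :
  {subset s <= posroots r} -> (0 < kostant (\sum_(a <- s) a))%N.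
Proof.
move=> s_pos; apply/kostant_gt0; exists [ffun a => count_mem (val a) s].
rewrite /partitions /=; transitivity (\sum_(a : seq_sub (posroots r))
    val a *+ count_mem (val a) s).
  by apply: eq_bigr => a _; rewrite ffunE.
elim: s s_pos => [|x s IHs] s_pos /=.
  by rewrite big_nil big1 // => a _; rewrite mulr0n.
rewrite big_cons -IHs => [|y ys]; last by rewrite s_pos // inE ys orbT.
under eq_bigr do rewrite mulrnDr.
rewrite big_split /=; congr (_ + _).
rewrite (bigD1 (SeqSub (s_pos x (mem_head x s)))) //= eqxx mulr1n.
rewrite big1 ?addr0 // => a.
by rewrite -val_eqE /= eq_sym => /negbTE ->.
Qed.

(** The simple-root coefficients of a positive root are nonnegative, hence so
    are those of anything that has a partition. *)
Lemma kostant_gt0_coweight (r k : nat) (xi : 'cV[rat]_r) :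
  (k <= r)%N -> (0 < kostant xi)%N -> 0 <= dot (coweight r k) xi.
Proof.
move=> kr /kostant_gt0[m <-]; rewrite dot_sumr; apply: sumr_ge0 => a _.
rewrite -scaler_nat dotZr mulr_ge0 // dot_coweight_posroot //.
exact: ssvalP.
Qed.

Lemma sum_alpha (r k : nat) :
  (0 < k <= r)%N -> \sum_(k <= i < r.+1) alpha r i = eps r k.
Proof.
case/andP=> _ kr; rewrite -(subKn kr).
elim: (r - k)%N (leq_subr k r) => [_|n IHn nr].
  by rewrite subn0 big_nat1 /alpha eqxx.
have rn : (r - n = (r - n.+1).+1)%N by rewrite -subSS subSn.
rewrite big_ltn ?ltnS ?leq_subr // -rn IHn; last exact: ltnW.
rewrite /alpha ifN -?rn ?subrK // neq_ltn.
by rewrite ltn_subrL (leq_trans _ nr).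
Qed.

Lemma rho_coord (r : nat) (j : 'I_r) : rho r j 0 = r%:R - j%:R - 2^-1.
Proof.
rewrite -dot_eps /rho dotZr (sum_seq_sub id (posroots_uniq r)) /posroots.
rewrite !big_cat /= !big_allpairs_dep big_map /= addrA -!big_split /=.
under eq_bigr => i _.
  rewrite -big_split /=; under eq_bigr do rewrite addrC addrACA subrr addr0.
  rewrite -mulr2n sumr_const_nat -mulrnA -mulrSr subSS -scaler_nat.
  over.
rewrite dot_sumr (bigD1_seq j.+1) ?iota_uniq ?mem_index_iota ?ltnS //=.
rewrite big1 ?addr0 => [|i /negbTE ij].
  rewrite dotZr dot_eps_eps ?ltn_ord // eqxx mulr1 -[(2 * _).+1%:R]natr1.
  rewrite natrM natrB ?ltn_ord //.
  by rewrite -[j.+1%:R]natr1; field.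
by rewrite dotZr dot_eps_eps ?ltn_ord // eq_sym ij mulr0.
Qed.

Lemma varpi1E (r : nat) : (2 <= r)%N -> varpi1 r = eps r 1.
Proof. by move=> r2; rewrite /varpi1 sum_alpha ?(ltnW r2). Qed.

Lemma highest_rootE (r : nat) :
  (2 <= r)%N -> highest_root r = varpi1 r + eps r 2.
Proof.
move=> r2; rewrite varpi1E // /highest_root -scaler_sumr sum_alpha ?r2 //.
rewrite /alpha ltn_eqF // scaler_nat mulr2n.
by rewrite addrA subrK.
Qed.

(** * Reflections *)

Lemma reflectionE (r : nat) (a v : 'cV[rat]_r) :
  reflection a *m v = v - (2 * dot a v / dot a a) *: a.
Proof.
rewrite mulmxBl mul1mx -scalemxAl -mulmxA; congr (_ - _).
have -> : a^T *m v = (dot a v)%:M.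
  apply/matrixP => i j; rewrite !ord1 !mxE eqxx mulr1n.
  by apply: eq_bigr => k _; rewrite mxE.
by rewrite mul_mx_scalar scalerA mulrAC.
Qed.

Lemma reflectionN (r : nat) (a : 'cV[rat]_r) : reflection (- a) = reflection a.
Proof.
rewrite /reflection dotNr (dotC (- a)) dotNr opprK.
by rewrite linearN /= mulNmx mulmxN opprK.
Qed.

(** This also covers [a = 0], where dividing by [dot a a = 0] makes the
    reflection the identity. *)
Lemma reflectionK (r : nat) (a v : 'cV[rat]_r) :
  reflection a *m (reflection a *m v) = v.
Proof.
rewrite !reflectionE dotBr dotZr; have [->|a0] := eqVneq (dot a a) 0.
  by rewrite invr0 !mulr0 scale0r !subr0.
rewrite -addrA -opprD -scalerDl [X in X *: a](_ : _ = 0) ?scale0r ?subr0 //.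
by field.
Qed.

Lemma simple_reflection_ltE (r i : nat) (v : 'cV[rat]_r) : (0 < i < r)%N ->
  simple_reflection r i *m v =
    v - (dot (eps r i) v - dot (eps r i.+1) v) *: alpha r i.
Proof.
move=> /andP[i0 ir]; rewrite /simple_reflection reflectionE.
rewrite /alpha ltn_eqF // !dotBl !dotBr !dot_eps_eps ?i0 ?ir ?(ltnW ir) //.
rewrite !eqxx ltn_eqF // gtn_eqF //; congr (_ - _ *: _).
by rewrite /=; field.
Qed.

Lemma simple_reflection_lastE (r : nat) (v : 'cV[rat]_r) : (0 < r)%N ->
  simple_reflection r r *m v = v - (2 * dot (eps r r) v) *: alpha r r.
Proof.
move=> r0; rewrite /simple_reflection reflectionE /alpha eqxx.
rewrite dot_eps_eps ?r0 ?leqnn //.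
by rewrite eqxx divr1.
Qed.

Lemma simple_reflection_fixed (r i : nat) (v : 'cV[rat]_r) :
  dot (alpha r i) v = 0 -> simple_reflection r i *m v = v.
Proof.
move=> v0; rewrite /simple_reflection reflectionE v0.
by rewrite mulr0 mul0r scale0r subr0.
Qed.

Lemma dot_alpha_far (r i j : nat) : (0 < i <= r)%N -> (0 < j <= r)%N ->
  i <> j -> i <> j.+1 -> j <> i.+1 -> dot (alpha r i) (alpha r j) = 0.
Proof.
move=> /andP[i0 ir] /andP[j0 jr] /eqP/negbTE ij /eqP/negbTE ij1 /eqP ji1.
have ij' : (i.+1 == j) = false by rewrite eq_sym; apply/negbTE.
rewrite /alpha; case: (eqVneq i r) => [ir'|ir'];
  case: (eqVneq j r) => [jr'|jr'].
- by move/eqP: ij; rewrite ir' jr'.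
- by rewrite -ir' dotBr !dot_eps_eps ?i0 ?leqnn // ij ij1 subr0.
- rewrite -jr' in ir ir' *.
  by rewrite dotBl !dot_eps_eps ?i0 // ?ij ?ij' ?subr0 //= ltn_neqAle ir' ir.
- have i1r : (i < r)%N by rewrite ltn_neqAle ir' ir.
  by rewrite dotBl !dotBr !dot_eps_eps ?i0 // eqSS ij ij1 ij' !subr0.
Qed.

Lemma eq_mulmx_cV (r : nat) (A B : 'M[rat]_r) :
  (forall v : 'cV[rat]_r, A *m v = B *m v) -> A = B.
Proof.
move=> AB; apply/matrixP => i j.
by have /matrixP/(_ i 0) := AB (delta_mx j 0); rewrite -!colE !mxE.
Qed.

(** * Weyl group elements as signed permutations *)

(** The permutation p sends a position of the image to the position its entry
    comes from, so that products compose as in [signed_perm_mul]. *)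
Definition signed_perm (r : nat) (p : 'S_r) (b : 'I_r -> bool)
    (w : 'M[rat]_r) : Prop :=
  forall (v : 'cV[rat]_r) (j : 'I_r), (w *m v) j 0 = (-1) ^+ b j * v (p j) 0.

Lemma signed_perm_mul (r : nat) p b p' b' (w w' : 'M[rat]_r) :
  signed_perm p b w -> signed_perm p' b' w' ->
  signed_perm (p * p')%g (fun j => b j (+) b' (p j)) (w *m w').
Proof.
by move=> wE w'E v j; rewrite -mulmxA wE w'E permM signr_addb mulrA.
Qed.

Lemma signed_perm_reflection (r : nat) (a : 'cV[rat]_r) :
  a \in Defs.roots r -> exists p b, signed_perm p b (reflection a).
Proof.
have pair (y : bool) (i j : 'I_r) : (i < j)%N -> exists p b,
    signed_perm p b (reflection (eps r i.+1 - (-1) ^+ y *: eps r j.+1)).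
  move=> ij; exists (tperm i j), (fun k => y && ((k == i) || (k == j))) => v k.
  have ne : (i == j) = false by apply/eqP => ij'; rewrite ij' ltnn in ij.
  have {}ne' : (j == i) = false by rewrite eq_sym.
  have ii : (i.+1 == j.+1) = false by rewrite eqSS val_eqE.
  rewrite reflectionE !(dotBl, dotBr, dotZl, dotZr) !dot_eps !mxE !eqxx.
  rewrite !eqSS !val_eqE ne ne'.
  by case: tpermP => [ki|kj|/eqP/negbTE ki /eqP/negbTE kj];
    rewrite ?ki ?kj ?eqxx ?ne ?ne'; case: y => /=; field.
have single (i : 'I_r) : exists p b, signed_perm p b (reflection (eps r i.+1)).
  exists 1%g, (pred1 i) => v k.
  rewrite reflectionE !dot_eps !mxE perm1 !eqSS !val_eqE eqxx /=.
  by case: (eqVneq k i) => [->|_] /=; field.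
have rng i k j : j \in index_iota i.+1 k.+1 ->
    exists2 j' : 'I_k, j = j'.+1 & (i <= j')%N.
  rewrite mem_index_iota; case: j => // j /andP[ij jk].
  by exists (Ordinal (jk : (j < k)%N)).
have pos x : x \in posroots r -> exists p b, signed_perm p b (reflection x).
  rewrite !mem_cat => /or3P[/allpairsPdep|/allpairsPdep|/mapP].
  - move=> [_ [_ [/rng[i -> _] /rng[j -> ij] ->]]].
    by have := pair false i j ij; rewrite expr0 scale1r.
  - move=> [_ [_ [/rng[i -> _] /rng[j -> ij] ->]]].
    by have := pair true i j ij; rewrite expr1 scaleN1r opprK.
  - by move=> [_ /rng[i -> _] ->].
rewrite mem_cat => /orP[/pos //|/mapP[x /pos x_pos ->]].
by rewrite reflectionN.
Qed.

Lemma weyl_signed_perm (r : nat) (w : 'M[rat]_r) :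
  weyl r w -> exists p b, signed_perm p b w.
Proof.
move=> [t + ->]; elim: t => [_|a t IHt at_roots].
  rewrite big_nil; exists 1%g, (fun=> false) => v j.
  by rewrite mul1mx perm1 mul1r.
have [p [b wE]] := signed_perm_reflection (at_roots a (mem_head a t)).
have [|p' [b' w'E]] := IHt.
  by move=> x xt; rewrite at_roots // inE xt orbT.
rewrite big_cons; exists (p * p')%g, (fun j => b j (+) b' (p j)).
exact: signed_perm_mul.
Qed.

(** * The dominant weights lambda + rho and mu + rho *)

Definition lambda_rho (r : nat) : 'cV[rat]_r := highest_root r + rho r.

Definition mu_rho (r : nat) : 'cV[rat]_r := varpi1 r + rho r.

Lemma lambda_rho_coord (r : nat) (j : 'I_r) : (2 <= r)%N ->
  lambda_rho r j 0 = r%:R - j%:R - 2^-1 + (j < 2)%N%:R.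
Proof.
move=> r2; rewrite mxE rho_coord highest_rootE // varpi1E // !mxE addrC.
by congr (_ + _); case: j => -[|[|j]].
Qed.

Lemma lambda_rho_sub_mu_rho (r : nat) :
  (2 <= r)%N -> lambda_rho r - mu_rho r = eps r 2.
Proof.
move=> r2; rewrite /lambda_rho highest_rootE // opprD addrACA subrr addr0.
by rewrite addrC addKr.
Qed.

Lemma mu_rho_coord (r : nat) (j : 'I_r) : (2 <= r)%N ->
  mu_rho r j 0 = lambda_rho r j 0 - (j == 1 :> nat)%:R.
Proof.
move=> r2; have -> : (j == 1 :> nat)%:R = eps r 2 j 0 by rewrite eps_coord.
by rewrite -sub_coord -lambda_rho_sub_mu_rho // opprB addrC subrK.
Qed.

Lemma lambda_rho_gt0 (r : nat) (j : 'I_r) : (2 <= r)%N -> 0 < lambda_rho r j 0.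
Proof.
move=> r2; have : j.+1%:R <= r%:R :> rat by rewrite ler_nat.
by rewrite lambda_rho_coord // -natr1; case: (j < 2)%N => /= ?; lra.
Qed.

Lemma lambda_rho_decr (r : nat) (j k : 'I_r) : (2 <= r)%N -> (j < k)%N ->
  lambda_rho r k 0 <= lambda_rho r j 0 - 1.
Proof.
move=> r2 jk; have : j.+1%:R <= k%:R :> rat by rewrite ler_nat.
have : (k < 2)%N%:R <= (j < 2)%N%:R :> rat.
  by rewrite ler_nat; case: (ltnP k 2) => // /(ltn_trans jk) ->.
by rewrite !lambda_rho_coord // -natr1; lra.
Qed.

Lemma lambda_rho_inj (r : nat) (j k : 'I_r) : (2 <= r)%N ->
  lambda_rho r j 0 = lambda_rho r k 0 -> j = k.
Proof.
move=> r2; have gap x : ~~ (x <= x - 1 :> rat) by rewrite -ltNge; lra.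
case: (ltngtP j k) => [| |/val_inj //] /(lambda_rho_decr r2) + jk;
  by rewrite jk (negbTE (gap _)).
Qed.

Lemma signed_perm_gt0 (r : nat) p b (w : 'M[rat]_r) (j : 'I_r) :
  (2 <= r)%N -> signed_perm p b w -> 0 < (w *m lambda_rho r) j 0 ->
  (w *m lambda_rho r) j 0 = lambda_rho r (p j) 0.
Proof.
move=> r2 wE; rewrite wE; case: (b j); last by rewrite expr0 mul1r.
by rewrite expr1 mulN1r oppr_gt0 ltNge ltW // lambda_rho_gt0.
Qed.

Lemma signed_perm_fix (r : nat) p b (w : 'M[rat]_r) (j : 'I_r) :
  (2 <= r)%N -> signed_perm p b w ->
  (w *m lambda_rho r) j 0 = lambda_rho r j 0 -> p j = j /\ b j = false.
Proof.
move=> r2 wE; rewrite wE; case: (b j) => /=.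
  move=> cj; have := lambda_rho_gt0 j r2.
  by rewrite -cj expr1 mulN1r oppr_gt0 ltNge ltW // lambda_rho_gt0.
by rewrite expr0 mul1r => /(lambda_rho_inj r2).
Qed.

(** The coordinates of lambda + rho are positive and distinct, so a signed
    permutation is determined by its value there. *)
Lemma lambda_rho_regular (r : nat) p b (w : 'M[rat]_r) :
  (2 <= r)%N -> signed_perm p b w ->
  w *m lambda_rho r = lambda_rho r -> w = 1%:M.
Proof.
move=> r2 wE wc; apply: eq_mulmx_cV => v; apply/colP => j.
have [|pj bj] := @signed_perm_fix _ _ _ _ j r2 wE; first by rewrite wc.
by rewrite wE pj bj mul1mx expr0 mul1r.
Qed.

(** * Products of non-consecutive simple reflections *)

(** For i >= 3 the highest root is orthogonal to alpha_i, so that lambda + rho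
    pairs to 1 with the coroot of alpha_i, as rho does. *)
Lemma simple_reflection_lambda_rho (r i : nat) : (3 <= i <= r)%N ->
  simple_reflection r i *m lambda_rho r = lambda_rho r - alpha r i.
Proof.
move=> /andP[i3 ir]; have r2 : (2 <= r)%N by rewrite (leq_trans _ ir) // ltnW.
case: i i3 ir => // i i3 ir.
have i2 : (i < 2)%N = false by rewrite ltnNge -ltnS i3.
have i12 : (i.+1 < 2)%N = false by rewrite ltnNge ltnW.
have [ir'|ir'] := eqVneq i.+1 r.
  subst r; rewrite simple_reflection_lastE //.
  rewrite (dot_eps (Ordinal ir)) lambda_rho_coord // i2.
  rewrite [X in X *: _](_ : _ = 1) ?scale1r //.
  by rewrite -natr1 /=; field.
have i1r : (i.+1 < r)%N by rewrite ltn_neqAle ir' ir.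
rewrite simple_reflection_ltE // (dot_eps (Ordinal ir)) (dot_eps (Ordinal i1r)).
rewrite !lambda_rho_coord // i2 i12.
rewrite [X in X *: _](_ : _ = 1) ?scale1r //.
by rewrite -natr1 /=; field.
Qed.

(** Non-adjacent simple roots are orthogonal, so each reflection subtracts its
    own root and fixes those already subtracted. *)
Lemma prod_simple_reflection_lambda_rho (r : nat) (t : seq nat) :
  non_consecutive t -> {in t, forall i : nat, (3 <= i <= r)%N} ->
  (\big[mulmx/1%:M]_(i <- t) simple_reflection r i) *m lambda_rho r =
    lambda_rho r - \sum_(i <- t) alpha r i.
Proof.
elim: t => [|i t IHt] [t_uniq t_far] t_rng.
  by rewrite !big_nil mul1mx subr0.
have sub j : j \in t -> j \in i :: t by rewrite inE orbC => ->.
move: t_uniq => /= /andP[it t_uniq].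
rewrite !big_cons -mulmxA IHt; last 2 first.
- by split=> // j k /sub jt /sub kt; apply: t_far.
- by move=> j /sub; apply: t_rng.
rewrite mulmxBr simple_reflection_lambda_rho ?t_rng ?mem_head //.
rewrite opprD addrA mulmx_sumr; congr (_ - _).
rewrite !big_seq; apply: eq_bigr => j jt.
have gt0 k : (3 <= k <= r -> 0 < k <= r)%N by case: k => // k /andP[_].
have ij : i <> j by move=> ij; rewrite ij jt in it.
rewrite simple_reflection_fixed // dot_alpha_far //.
- by apply/gt0/t_rng/mem_head.
- by apply/gt0/t_rng/sub.
- exact: t_far (sub _ jt) (mem_head i t).
- exact: t_far (mem_head i t) (sub _ jt).
Qed.

(** * Recovering the reflections from the partial sums *)

(** Once the first m values of lambda + rho sit in their places, they are no
    longer available to the later positions. *)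
Lemma signed_perm_fix_ge (r : nat) p b (w : 'M[rat]_r) (m : nat) :
  (2 <= r)%N -> signed_perm p b w ->
  (forall j : 'I_r, (j < m)%N -> (w *m lambda_rho r) j 0 = lambda_rho r j 0) ->
  forall k : 'I_r, (m <= k)%N -> (m <= p k)%N.
Proof.
move=> r2 wE fixm k mk; rewrite leqNgt; apply/negP => pk.
have [ppk _] := signed_perm_fix r2 wE (fixm _ pk).
by move: pk; rewrite (perm_inj ppk) ltnNge mk.
Qed.

Lemma dot_coweight_fix (r m : nat) (u v : 'cV[rat]_r) : (m <= r)%N ->
  (forall j : 'I_r, (j < m)%N -> u j 0 = v j 0) ->
  dot (coweight r m) u = dot (coweight r m) v.
Proof.
move=> mr uv; rewrite !dot_coweight; apply: eq_big_nat => -[//|k] /andP[_ km].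
by rewrite !(dot_eps (Ordinal (leq_trans (km : (k < m)%N) mr))) uv.
Qed.

(** At the first position j where w (lambda + rho) departs from lambda + rho,
    nonnegativity allows a loss of at most 1. Hence either j is followed by a
    position and the two values there are swapped, or j is the last position
    and the value 1/2 changed sign. In both cases w (lambda + rho) pairs to -1
    with the coroot of alpha_(m+1), and reflecting restores every coordinate
    involved. *)
Lemma reflect_first_change (r m : nat) p b (w : 'M[rat]_r) (j : 'I_r) :
  (2 <= m)%N -> signed_perm p b w -> j = m :> nat ->
  (forall i : 'I_r, (i < m)%N -> (w *m lambda_rho r) i 0 = lambda_rho r i 0) ->
  (forall k, (k <= r)%N ->
     0 <= dot (coweight r k) (w *m lambda_rho r - mu_rho r)) ->
  (w *m lambda_rho r) j 0 <> lambda_rho r j 0 ->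
  simple_reflection r m.+1 *m (w *m lambda_rho r) =
    w *m lambda_rho r + alpha r m.+1 /\
  (forall i : 'I_r, (i < minn m.+2 r)%N ->
    (w *m lambda_rho r + alpha r m.+1) i 0 = lambda_rho r i 0).
Proof.
move=> m2 wE jm fixm wc_pos wcj.
have mr : (m < r)%N by rewrite -jm.
have r2 : (2 <= r)%N by rewrite (leq_trans m2) // ltnW.
have pge := signed_perm_fix_ge r2 wE fixm.
(* The partial sums have a slack of 1 at m, coming from lambda - mu = eps_2. *)
have sum_m : dot (coweight r m) (w *m lambda_rho r - mu_rho r) = 1.
  rewrite dotBr (dot_coweight_fix (ltnW mr) fixm) -dotBr.
  by rewrite lambda_rho_sub_mu_rho // dot_coweight_eps ?m2 // ltnW.
have mu_ge (k : 'I_r) : (2 <= k)%N -> mu_rho r k 0 = lambda_rho r k 0.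
  by move=> k2; rewrite mu_rho_coord // gtn_eqF // subr0.
set v := w *m lambda_rho r in fixm wc_pos wcj *.
have vj_ge : lambda_rho r j 0 - 1 <= v j 0.
  have := wc_pos m.+1 mr; rewrite coweightS dotDl sum_m -{1}jm dot_eps.
  by rewrite sub_coord mu_ge ?jm //; lra.
have not_neg k : 0 < v k 0 -> v k 0 = lambda_rho r (p k) 0.
  exact: signed_perm_gt0.
(* On the last coordinate the only other available value is - 1/2. *)
have [r_eq|m1r] := eqVneq m.+1 r.
  have pj : p j = j.
    apply/val_inj/eqP; rewrite eqn_leq /= {2}jm pge ?jm // -ltnS r_eq.
    by rewrite ltn_ord.
  have vj : v j 0 = - lambda_rho r j 0.
    move: wcj; rewrite /v wE pj; case: (b j); last by rewrite expr0 mul1r.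
    by rewrite expr1 mulN1r.
  have cj : lambda_rho r j 0 = 2^-1.
    rewrite lambda_rho_coord // jm ltnNge m2 -r_eq -natr1 /=; lra.
  split.
    have er : dot (eps r r) v = v j 0 by rewrite -dot_eps jm r_eq.
    rewrite r_eq simple_reflection_lastE ?(ltnW r2) // er vj cj.
    by rewrite mulrN mulfV // scaleN1r opprK.
  move=> i _; rewrite mxE /alpha r_eq eqxx eps_coord -[X in _ == X]r_eq eqSS.
  have [im|im] := eqVneq (i : nat) m.
    have -> : i = j by apply: val_inj; rewrite /= im jm.
    by rewrite vj cj /=; lra.
  rewrite addr0 fixm // ltn_neqAle im /= -ltnS r_eq.
  exact: ltn_ord.
have {}m1r : (m.+1 < r)%N by rewrite ltn_neqAle m1r mr.
pose j1 := Ordinal m1r.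
have jj1 : (j < j1)%N by rewrite jm /=.
have vj : v j 0 = lambda_rho r (p j) 0.
  apply: not_neg; apply: lt_le_trans vj_ge.
  apply: lt_le_trans (lambda_rho_gt0 j1 r2) _.
  exact: lambda_rho_decr.
(* The slack leaves only the next smaller coordinate of lambda + rho. *)
have pj : p j = j1.
  apply: val_inj => /=; case: (ltngtP (p j) m.+1) => //.
    rewrite ltnS => pjm; case: wcj; rewrite vj; congr (lambda_rho r _ 0).
    by apply/val_inj/eqP; rewrite /= eqn_leq jm pjm pge ?jm.
  move=> /(@lambda_rho_decr _ j1 (p j) r2); rewrite -vj => /(le_trans vj_ge).
  by rewrite lerD2r leNgt (le_lt_trans (lambda_rho_decr r2 jj1)) //; lra.
have cj1 : lambda_rho r j1 0 = lambda_rho r j 0 - 1.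
  by apply/le_anti; rewrite -{2}pj -vj vj_ge lambda_rho_decr.
(* The slack is now used up, so position j1 must hold the skipped value. *)
have vj1_ge : lambda_rho r j1 0 <= v j1 0.
  have := wc_pos m.+2 m1r; rewrite !coweightS !dotDl sum_m -{1}jm.
  rewrite (dot_eps j) (dot_eps j1) !sub_coord.
  have mu_j := mu_ge j; have mu_j1 := mu_ge j1.
  by rewrite mu_j ?jm // mu_j1 ?leqW // vj pj; lra.
have vj1 : v j1 0 = lambda_rho r (p j1) 0.
  by apply: not_neg; apply: lt_le_trans vj1_ge; apply: lambda_rho_gt0.
have pj1 : p j1 = j.
  apply: val_inj => /=; case: (ltngtP (p j1) m.+1).
  - rewrite ltnS => pjm; apply/eqP; rewrite eqn_leq jm pjm pge //=.
  - move=> /(@lambda_rho_decr _ j1 (p j1) r2); rewrite -vj1.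
    move=> /(le_trans vj1_ge).
    by rewrite lerDl oppr_ge0 ler10.
  - move=> pj1; have /perm_inj/(congr1 val)/= : p j1 = p j.
      by rewrite pj; apply: val_inj.
    by rewrite jm => /eqP; rewrite gtn_eqF.
split.
  rewrite simple_reflection_ltE // -{1}jm dot_eps (dot_eps j1).
  by rewrite vj pj vj1 pj1 cj1 addrAC subrr add0r scaleN1r opprK.
move=> i; rewrite leq_min => /andP[i2 _].
rewrite mxE /alpha ltn_eqF // sub_coord !eps_coord !eqSS.
have [im|im] := eqVneq (i : nat) m.
  have -> : i = j by apply: val_inj; rewrite /= im jm.
  by rewrite ltn_eqF // vj pj cj1 subr0 subrK.
have [im1|im1] := eqVneq (i : nat) m.+1.
  have -> : i = j1 by apply: val_inj.
  by rewrite vj1 pj1 cj1 sub0r.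
by rewrite subrr addr0 fixm // ltn_neqAle im -ltnS ltn_neqAle im1.
Qed.

(** Induction on the number of coordinates still to be settled. Reflecting at
    the first change adds a positive root, so nonnegativity is preserved. *)
Lemma peel_simple_reflections (r m : nat) p b (w : 'M[rat]_r) :
  (2 <= m <= r)%N -> signed_perm p b w ->
  (forall j : 'I_r, (j < m)%N -> (w *m lambda_rho r) j 0 = lambda_rho r j 0) ->
  (forall k, (k <= r)%N ->
     0 <= dot (coweight r k) (w *m lambda_rho r - mu_rho r)) ->
  exists t : seq nat,
     [/\ non_consecutive t,
         {in t, forall i : nat, (m < i <= r)%N}
       & w = \big[mulmx/1%:M]_(i <- t) simple_reflection r i].
Proof.
have [n] := ubnP (r - m)%N; elim: n m p b w => // n IHn m p b w.
rewrite ltnS => rmn /andP[m2 mr] wE fixm wc_pos.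
have r2 := leq_trans m2 mr.
have [m_eq|m_neq] := eqVneq m r.
  exists [::]; split=> //; rewrite big_nil.
  by apply: lambda_rho_regular r2 wE _; apply/colP => j; rewrite fixm // m_eq.
have {m_neq}mr' : (m < r)%N by rewrite ltn_neqAle m_neq mr.
pose j := Ordinal mr'.
have rSm m' : (m < m')%N -> (r - m' < n)%N.
  by move=> mm'; apply: leq_trans rmn; rewrite ltn_sub2l.
have [wcj|/eqP wcj] := eqVneq ((w *m lambda_rho r) j 0) (lambda_rho r j 0).
  have [|i|//|t [t_nc t_rng ->]] := IHn m.+1 p b w (rSm _ (ltnSn m)) _ wE.
  - by rewrite mr' (leq_trans m2).
  - rewrite ltnS leq_eqVlt => /orP[/eqP im|/fixm //].
    by have -> : i = j by apply: val_inj.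
  by exists t; split=> // i /t_rng /andP[/ltnW -> ->].
have [swE swc] :=
  reflect_first_change m2 wE (erefl : j = m :> nat) fixm wc_pos wcj.
set s := simple_reflection r m.+1 in swE *.
have al_pos : alpha r m.+1 \in posroots r by rewrite alpha_posroots.
have [p' [b' sE]] : exists p b, signed_perm p b s.
  by apply: signed_perm_reflection; rewrite mem_cat al_pos.
have [|||k kr|t [t_nc t_rng sw_eq]] :=
  IHn (minn m.+2 r) _ _ (s *m w) _ _ (signed_perm_mul sE wE).
- by rewrite rSm // leq_min leqW.
- by rewrite leq_min geq_minr r2 !andbT (leq_trans m2) // leqW.
- by move=> i im; rewrite -mulmxA swE swc.
- rewrite -mulmxA swE addrAC dotDr addr_ge0 ?wc_pos //.
  exact: dot_coweight_posroot.
(* Coordinates m and m.+1 are settled at once, so no later reflection is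
   adjacent to s_(m.+1). *)
have t_gt i : i \in t -> (m.+2 < i <= r)%N.
  move=> /t_rng; rewrite gtn_min => /andP[/orP[->|/ltn_geF ri] ir] //.
  by rewrite ri in ir.
exists (m.+1 :: t); split.
- case: t_nc => t_uniq t_far; split.
    by rewrite /= t_uniq andbT; apply/negP => /t_gt; rewrite ltnNge leqW.
  move=> i k; rewrite !inE => /orP[/eqP->|it] /orP[/eqP->|kt];
    last exact: t_far.
  + by move=> /eqP; rewrite ltn_eqF.
  + by move=> ki; have := t_gt _ kt; rewrite ki ltnn.
  + by move=> mi; have := t_gt _ it; rewrite mi ltnNge leqW // leqW.
- move=> i; rewrite inE => /orP[/eqP->|/t_gt /andP[mi ->]]; first by
    rewrite leqnn.
  by rewrite (leq_trans _ mi) // leqW.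
rewrite big_cons -sw_eq mulmxA; apply: eq_mulmx_cV => v.
by rewrite -!mulmxA reflectionK.
Qed.

Lemma first_two_fixed (r : nat) p b (w : 'M[rat]_r) :
  (2 <= r)%N -> signed_perm p b w ->
  (forall k, (k <= r)%N ->
     0 <= dot (coweight r k) (w *m lambda_rho r - mu_rho r)) ->
  forall j : 'I_r, (j < 2)%N -> (w *m lambda_rho r) j 0 = lambda_rho r j 0.
Proof.
move=> r2 wE wc_pos.
set v := w *m lambda_rho r in wc_pos *.
have not_neg k : 0 < v k 0 -> v k 0 = lambda_rho r (p k) 0.
  exact: signed_perm_gt0.
pose i0 : 'I_r := Ordinal (ltnW r2); pose i1 : 'I_r := Ordinal r2.
(* The first coordinate must be at least the largest one of lambda + rho. *)
have v0_ge : lambda_rho r i0 0 <= v i0 0.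
  have := wc_pos 1%N (ltnW r2); rewrite coweightS dotDl dot_coweight big_geq //.
  by rewrite (dot_eps i0) sub_coord mu_rho_coord //= add0r subr0 subr_ge0.
have v0 := not_neg _ (lt_le_trans (lambda_rho_gt0 i0 r2) v0_ge).
have p0 : p i0 = i0.
  apply: val_inj => /=; case: (posnP (p i0)) => //.
  move=> /(@lambda_rho_decr _ i0 _ r2).
  by rewrite -v0 => /(le_trans v0_ge); rewrite lerDl oppr_ge0 ler10.
(* The next value available after that of i1 is smaller by 2, but lambda and
   mu differ there by only 1. *)
have v1_ge : lambda_rho r i1 0 - 1 <= v i1 0.
  have := wc_pos 2%N r2; rewrite !coweightS !dotDl dot_coweight big_geq //.
  rewrite (dot_eps i0) (dot_eps i1) !sub_coord !mu_rho_coord //= v0 p0; lra.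
have c1 : lambda_rho r i1 0 = r%:R - 2^-1.
  by rewrite lambda_rho_coord //=; lra.
have r2' : 2 <= r%:R :> rat by rewrite ler_nat.
have v1 : v i1 0 = lambda_rho r (p i1) 0 by apply: not_neg; lra.
have p1 : p i1 = i1.
  apply: val_inj => /=; case: (ltngtP (p i1) 1) => // [|p1].
    rewrite ltnS leqn0 => /eqP p1; have /perm_inj/(congr1 val) // : p i1 = p i0.
    by rewrite p0; apply: val_inj.
  move: v1_ge; rewrite v1 c1 lambda_rho_coord // ltnNge p1 /= leNgt.
  have : 2 <= (p i1)%:R :> rat by rewrite ler_nat.
  by move=> ?; case/negP; lra.
move=> [[|[|//]] jr] _.
- by rewrite (_ : Ordinal jr = i0) ?v0 ?p0 //; apply: val_inj.
- by rewrite (_ : Ordinal jr = i1) ?v1 ?p1 //; apply: val_inj.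
Qed.

(** * The Weyl alternation set *)

Theorem theorem8p3 (r : nat) (hr : (2 <= r)%N) (sigma : 'M[rat]_r)
    (hsigma : weyl r sigma) :
  alternation_set (highest_root r) (varpi1 r) sigma <->
  (sigma = 1%:M \/
   exists t : seq nat,
     [/\ t <> [::],
         non_consecutive t,
         {in t, forall i : nat, (3 <= i <= r)%N}
       & sigma = \big[mulmx/1%:M]_(i <- t) simple_reflection r i]).
Proof.
(* The empty product accounts for sigma = 1. *)
suff -> : alternation_set (highest_root r) (varpi1 r) sigma <->
    exists t : seq nat, [/\ non_consecutive t,
      {in t, forall i : nat, (3 <= i <= r)%N}
      & sigma = \big[mulmx/1%:M]_(i <- t) simple_reflection r i].
  split=> [[[|i t] [t_nc t_rng ->]]|[->|[t [_ t_nc t_rng ->]]]].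
  - by left; rewrite big_nil.
  - by right; exists (i :: t).
  - by exists [::]; rewrite big_nil.
  - by exists t.
split=> [[_ xi_pos]|[t [t_nc t_rng sigmaE]]].
  have [p [b sigma_perm]] := weyl_signed_perm hsigma.
  have wc_pos k : (k <= r)%N ->
      0 <= dot (coweight r k) (sigma *m lambda_rho r - mu_rho r).
    by move=> kr; apply: kostant_gt0_coweight.
  apply: (peel_simple_reflections _ sigma_perm _ wc_pos); first by rewrite hr.
  exact: first_two_fixed sigma_perm wc_pos.
split=> //; rewrite -/(lambda_rho r) -/(mu_rho r) sigmaE.
rewrite prod_simple_reflection_lambda_rho // addrAC lambda_rho_sub_mu_rho //.
rewrite -(@sum_alpha r 2) ?hr // (bigID (mem t)) /=.
have -> : \sum_(2 <= i < r.+1 | i \in t) alpha r i = \sum_(i <- t) alpha r i.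
  rewrite -big_filter; apply: perm_big; apply: uniq_perm => [||i].
  - by rewrite filter_uniq ?iota_uniq.
  - by case: t_nc.
  rewrite mem_filter mem_index_iota ltnS; case it: (i \in t) => //=.
  by have /andP[/ltnW -> ->] := t_rng i it.
rewrite addrAC subrr add0r -big_filter.
rewrite -(big_map (alpha r) xpredT id); apply: kostant_gt0_sum => a /mapP[i].
rewrite mem_filter mem_index_iota ltnS => /and3P[_ i2 ir] ->.
by rewrite alpha_posroots // ir (ltnW i2).
Qed.
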